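(* Let $\tilde C_n(\tilde Y_n)$ be a credible set for $v$ in model (L), and define $$C_n(Y_n):=\{f:\mathcal L u_f\in\tilde C_n(Y_n-\tilde g)\}=\{e(v):v\in\tilde C_n(Y_n-\tilde g)\}.$$ (1) The credible levels of the credible sets $\tilde C_n(\tilde Y_n)$ for $v$ in model (L) and $C_n(Y_n)$ for $f$ in model (N) are equal, and so are the coverage levels of these sets at $v_0=\mathcal L u_{f_0}$ and $f_0$, respectively. (2) Furthermore, if the map $e:V_n\to L_2(\mathcal O)$ is uniformly Lipschitz at points $\bar v_n\in V_n$ (there is a constant $C$ not depending on $n$ with $\|e(v)-e(\bar v_n)\|_{L_2}\le C\|v-\bar v_n\|$ for all $v\in V_n$) and $\tilde C_n(\tilde Y_n)\subset V_n$, then on the event $\bar v_n\in\tilde C_n(\tilde Y_n)$ the $L_2$-diameters of the sets $C_n(Y_n)$ are of the same order in probability under $f_0$ as the $\|\cdot\|$-diameters of the sets $\tilde C_n(\tilde Y_n)$ under $v_0$.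
   Context: Setting. $\mathcal O\subset\mathbb R^d$ is a bounded connected open set with Lipschitz boundary, $\Gamma\subseteq\partial\mathcal O$, $g:\Gamma\to\mathbb R$ is known, $\mathcal L$ is a linear differential operator and $c$ maps pairs of functions to functions on $\mathcal O$. For an unknown function $f$ on $\mathcal O$, $u_f$ denotes the solution of $\mathcal L u_f=c(f,u_f)$ on $\mathcal O$, $u_f=g$ on $\Gamma$. The linear operator $K$ is the inverse of $\mathcal L$ under zero boundary condition: $\mathcal L Ku=u$ on $\mathcal O$, $Ku=0$ on $\Gamma$. The function $\tilde g$ satisfies $\mathcal L\tilde g=0$ on $\mathcal O$, $\tilde g=g$ on $\Gamma$. It is assumed that $v=0$ is the only solution of $\mathcal Lv=0$ on $\mathcal O$, $v=0$ on $\Gamma$; hence $u_f=K\mathcal L u_f+\tilde g$. The map $e$ is a solution map, i.e. $f=e(\mathcal L u_f)$. Observations. $Y_n=u_f+n^{-1/2}\dot{\mathbb W}$ means either (white noise) the Gaussian process $Y_n(h)=\langle h,u_f\rangle_{L_2}+n^{-1/2}\dot{\mathbb W}(h)$, $h\in L_2(\mathcal O)$, with $\dot{\mathbb W}$ mean-zero Gaussian with covariance $\langle h_1,h_2\rangle_{L_2}$, or (discrete) the vector with coordinates $u_f(x_{n,i})+W_i$, $i=1,\dots,n$, for given design points $x_{n,i}\in\mathcal O$ and i.i.d. standard normal $W_i$. The observations $\tilde Y_n$ and $Y_n-\tilde g$ are identified, so that the assertions can be understood in an almost sure sense. Posteriors. A prior is put on $v=\mathcal L u_f$, with posterior distribution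 a Borel law on a normed space $(V,\|\cdot\|)$. Model (L): $\tilde\Pi_n(v\in\cdot\mid\tilde Y_n)$ is the posterior of $v$ in the model $\tilde Y_n=Kv+n^{-1/2}\dot{\mathbb W}$. Model (N): $\Pi_n(f\in\cdot\mid Y_n)$ is the posterior of $f$ in the model $Y_n=u_f+n^{-1/2}\dot{\mathbb W}$ under the prior on $f=e(v)$ induced by the prior on $v$; it equals $\tilde\Pi_n(e(v)\in\cdot\mid\tilde Y_n)$. The map $e$ is defined on a set of full prior probability; if $v$ is not of the form $\mathcal L u_f$ for a solution $u_f$ of the PDE, one defines $f=e(v)$ and $u_f=Kv+\tilde g$, so that $v=\mathcal L u_f$, $f=e(\mathcal L u_f)$ and $u_f=K\mathcal L u_f+\tilde g$ always hold. $V_n\subset V$ are given sets. A credible set $\tilde C_n(\tilde Y_n)$ is a set of prescribed probability under the posterior distribution. The credible level of $\tilde C_n(\tilde Y_n)$ is $\tilde\Pi_n(\tilde C_n(\tilde Y_n)\mid\tilde Y_n)$ and its coverage at $v_0$ is $\Pr_{v_0}(\tilde C_n(\tilde Y_n)\ni v_0)$ when $\tilde Y_n=Kv_0+n^{-1/2}\dot{\mathbb W}$. For $C_n(Y_n)$ in model (N) these are defined analogously, relative to $f$ with true value $f_0$.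
   Formalization: In (2), ''of the same order'' is proved only as an upper bound: the L_2-diameters of C_n are O_P of the diameters of the credible sets for v; the reverse bound fails in general, since a Lipschitz bound on e gives no lower bound. *)

(* Defs.v *)
From HB Require Import structures.
From mathcomp Require Import all_boot all_order all_algebra.
From mathcomp Require Import all_classical all_reals all_analysis.

Set Implicit Arguments.
Unset Strict Implicit.
Unset Printing Implicit Defensive.

Import Order.TTheory GRing.Theory Num.Theory.
Import numFieldNormedType.Exports.

Local Open Scope classical_set_scope.
Local Open Scope ring_scope.

(* The dimension of the Euclidean space is d.+1, so that it is at least 1. *)
Notation eucl R d := 'rV[R]_d.+1.

Notation borel T := (g_sigma_algebraType (@open T)).

Section Domain.
Context {R : realType} {d : nat}.
Local Notation X := (eucl R d).

Definition boundary (O : set X) : set X := closure O `\` interior O.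

(* After a rotation Q, O is near each boundary point the strict epigraph of a
   Lipschitz function phi of the last d coordinates. *)
Definition lipschitz_boundary (O : set X) : Prop :=
  forall x, boundary O x ->
  exists (Q : 'M[R]_d.+1) (phi : 'rV[R]_d -> R) (k r : R),
    [/\ Q *m Q^T = 1%:M, 0 < r,
        forall a b, `|phi a - phi b| <= k * `|a - b| &
        forall y, ball x r y ->
          (O y <-> phi (col' ord0 (y *m Q)) < (y *m Q) ord0 ord0)].

(* The Borel measure determined by the volumes of boxes. *)
Definition is_lebesgue (lam : {measure set (borel X) -> \bar R}) : Prop :=
  forall a b : X, (forall i, a ord0 i <= b ord0 i) ->
    lam [set x : X | forall i, a ord0 i <= x ord0 i <= b ord0 i] =
    (\prod_i (b ord0 i - a ord0 i))%:E.

(* A function on O is represented by its extension by zero. *)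
Definition fun_on (O : set X) : set (X -> R) :=
  [set f | forall x, ~ O x -> f x = 0].

(* Thanks to the extension by zero, the integrals over the whole space used in
   Lfun and in the norm are integrals over O. *)
Definition L2 (lam : {measure set (borel X) -> \bar R}) (O : set X) :
    set (X -> R) :=
  [set f | fun_on O f /\ (f : borel X -> R) \in Lfun lam 2%:E].

Definition L2dist (lam : {measure set (borel X) -> \bar R}) (f h : X -> R) :
    \bar R :=
  'N[lam]_2%:E[EFin \o ((fun x => (f x - h x)%R) : borel X -> R)]%E.

Definition L2inner (lam : {measure set (borel X) -> \bar R}) (O : set X)
    (f h : X -> R) : R :=
  \int[lam]_(x in (O : set (borel X))) (f x * h x).

Definition linear_on (W : lmodType R) (U : set (X -> R)) (T : (X -> R) -> W) :=
  forall (a : R) u w, U u -> U w ->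
    T (fun x => a * u x + w x) = a *: T u + T w.

(* The multi-indices are lists of directions: dpart [:: i; j] is the mixed
   derivative with respect to the coordinates i and j. *)
Definition dpart (s : seq 'I_d.+1) (phi : X -> R) : X -> R :=
  foldr (fun i h x => 'D_(delta_mx ord0 i : X) h x) phi s.

Definition test_function (O : set X) (phi : X -> R) : Prop :=
  (forall s, continuous (dpart s phi) /\
     forall i x, derivable (dpart s phi) x (delta_mx ord0 i : X)) /\
  exists A, [/\ compact A, A `<=` O & forall x, ~ A x -> phi x = 0].

Definition loc_integrable (lam : {measure set (borel X) -> \bar R})
    (O : set X) (u : X -> R) : Prop :=
  forall A : set X, compact A -> A `<=` O ->
    lam.-integrable (A : set (borel X)) (EFin \o (u : borel X -> R)).

Definition weak_derivative (lam : {measure set (borel X) -> \bar R})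
    (O : set X) (s : seq 'I_d.+1) (u w : X -> R) : Prop :=
  [/\ loc_integrable lam O u, loc_integrable lam O w &
      forall phi, test_function O phi ->
        L2inner lam O u (dpart s phi) = (-1) ^+ size s * L2inner lam O w phi].

(* L u = \sum_s a_s D^s u almost everywhere on O, with weak derivatives; only
   the derivatives that occur in the operator are required to exist. *)
Definition differential_operator (lam : {measure set (borel X) -> \bar R})
    (O : set X) (U : set (X -> R)) (L : (X -> R) -> X -> R) : Prop :=
  exists (S : seq (seq 'I_d.+1)) (a : seq 'I_d.+1 -> X -> R),
    forall u, U u -> exists Du : seq 'I_d.+1 -> X -> R,
      (forall s, s \in S -> weak_derivative lam O s u (Du s)) /\
      {ae lam, forall x : borel X, O x ->
        L u x = \sum_(s <- S) a s x * Du s x}.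

(* tr u is the boundary value of u; it is the pointwise one as soon as u
   extends continuously to G, and may otherwise be, e.g., a Sobolev trace. *)
Definition boundary_trace (O G : set X) (U : set (X -> R))
    (tr : (X -> R) -> X -> R) : Prop :=
  (forall x, G x -> linear_on U (fun u => tr u x : R^o)) /\
  forall u h, U u -> (forall x, G x -> u @ within O (nbhs x) --> h x) ->
    forall x, G x -> tr u x = h x.

End Domain.

Section Problem.
Context {R : realType} {d : nat}.
Local Notation X := (eucl R d).

(* The Dirichlet problem L u = c(f, u) on O, u = g on G, where L is lop, O is
   odom, G is bndy and g is bval.  The space usp is the one in which solutions
   are sought.  The elements of the normed space V are functions on O through
   the injection vfun, and the values of L lie in V.  Both usp and the range of
   vfun consist of genuine functions, which can be evaluated at design points;
   when the functions are only given almost everywhere, these are linearly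
   chosen representatives of the classes. *)
Record pde (V : normedModType R) := Pde {
  lam : {measure set (borel X) -> \bar R};
  odom : set X;
  bndy : set X;
  bval : X -> R;
  usp : set (X -> R);
  btrace : (X -> R) -> X -> R;
  vfun : V -> X -> R;
  lop : (X -> R) -> V;
  cmap : (X -> R) -> (X -> R) -> X -> R;
  kop : V -> X -> R;
  gtilde : X -> R;

  lam_lebesgue : is_lebesgue lam;
  odom_bounded : bounded_set odom;
  odom_open : open odom;
  odom_nonempty : odom !=set0;
  odom_connected : connected odom;
  odom_lipschitz : lipschitz_boundary odom;
  bndy_boundary : bndy `<=` boundary odom;

  usp_fun : usp `<=` fun_on odom;
  usp_zero : usp (fun=> 0);
  usp_linear : forall (a : R) u w,
    usp u -> usp w -> usp (fun x => a * u x + w x);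
  btrace_trace : boundary_trace odom bndy usp btrace;

  vfun_fun : forall v, fun_on odom (vfun v);
  vfun_inj : injective vfun;
  vfun_linear : forall (a : R) v w x,
    vfun (a *: v + w) x = a * vfun v x + vfun w x;

  lop_linear : linear_on usp lop;
  lop_diff : differential_operator lam odom usp (fun u => vfun (lop u));
  lop_unique : forall w, usp w -> lop w = 0 ->
    (forall x, bndy x -> btrace w x = 0) -> w = (fun=> 0);

  kop_space : forall v, usp (kop v);
  kop_linear : forall (a : R) v w,
    kop (a *: v + w) = (fun x => a * kop v x + kop w x);
  kop_inverse : forall v, lop (kop v) = v;
  kop_boundary : forall v x, bndy x -> btrace (kop v) x = 0;

  gtilde_space : usp gtilde;
  gtilde_null : lop gtilde = 0;
  gtilde_boundary : forall x, bndy x -> btrace gtilde x = bval x;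
}.

Definition solution (V : normedModType R) (p : pde V) (f w : X -> R) : Prop :=
  [/\ usp p w,
      {ae lam p, forall x : borel X,
        odom p x -> vfun p (lop p w) x = cmap p f w x} &
      forall x, bndy p x -> btrace p w x = bval p x].

(* fset is the set of functions f for which the problem has a (unique) solution
   u_f; usol f is u_f, and emap is only meaningful on edom.  For v in edom that
   is not of the form L u_f with f in fset, the function u_f attached to
   f = e(v) is K v + gtilde by convention. *)
Record solution_map (V : normedModType R) (p : pde V) := SolutionMap {
  fset : set (X -> R);
  edom : set V;
  emap : V -> X -> R;
  usol : (X -> R) -> X -> R;

  edom_measurable : measurable (edom : set (borel V));
  fset_fun : fset `<=` fun_on (odom p);
  emap_fun : forall v, edom v -> fun_on (odom p) (emap v);
  usol_solution : forall f, fset f -> solution p f (usol f);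
  usol_unique : forall f w, fset f -> solution p f w -> w = usol f;
  emap_domain : forall f, fset f -> edom (lop p (usol f));
  emap_solution : forall f, fset f -> emap (lop p (usol f)) = f;
  usol_convention : forall v, edom v ->
    ~ (exists2 f, fset f & v = lop p (usol f)) ->
    usol (emap v) = (fun x => kop p v x + gtilde p x);
}.

(* The values e(v): the parameter set for f in the nonlinear model. *)
Definition params (V : normedModType R) (p : pde V) (m : solution_map p) :
    set (X -> R) :=
  [set emap m v | v in edom m].

End Problem.

(* The sigma-algebra on functions f is the largest one for which e is
   measurable on its domain, so that laws of v induce laws of e(v). *)
Notation fspace m :=
  (g_sigma_algebraType (image_set_system (edom m) (emap m)
     (@measurable _ (borel _)))).

Definition cylinders (R : realType) (I : Type) : set (set (I -> R)) :=
  [set A | exists i (B : set R), measurable B /\ A = [set y | B (y i)]].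

(* Data indexed by I, with the product sigma-algebra. *)
Notation data R I := (g_sigma_algebraType (@cylinders R I)).

Section Observation.
Context {R : realType} {d : nat}.
Local Notation X := (eucl R d).

Inductive observation :=
  | WhiteNoise
  | Discrete of (forall n, 'I_n -> X).

Context {V : normedModType R}.
Variable p : pde (d := d) V.

Definition L2fun : Type := {h : X -> R | L2 (lam p) (odom p) h}.

(* Y_n is a family of real variables: indexed by the h in L_2(O) under white
   noise, by the n design points otherwise. *)
Definition obs_index (o : observation) (n : nat) : Type :=
  match o with
  | WhiteNoise => L2fun
  | Discrete _ => 'I_n
  end.

Definition obs_mean (o : observation) (n : nat) (u : X -> R) :
    obs_index o n -> R :=
  match o return obs_index o n -> R with
  | WhiteNoise => fun h => L2inner (lam p) (odom p) (sval h) u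
  | Discrete x => fun i => u (x n i)
  end.

Definition obs_defined (o : observation) : Prop :=
  match o with
  | WhiteNoise => usp p `<=` L2 (lam p) (odom p)
  | Discrete x => forall n i, odom p (x n i)
  end.

(* normal_prob m 0 is not the Dirac mass at m. *)
Definition has_normal_law (d0 : measure_display) (Om : measurableType d0)
    (P : probability Om R) (W : Om -> R) (m s : R) : Prop :=
  measurable_fun setT W /\
  forall B : set R, measurable B -> P (W @^-1` B) =
    if s == 0 then \d_m B else normal_prob m s B.

Definition white_noise (d0 : measure_display) (Om : measurableType d0)
    (P : probability Om R) (W : Om -> L2fun -> R) : Prop :=
  [/\ forall k (a : 'I_k -> R) (h : 'I_k -> L2fun),
        exists m s, has_normal_law P (fun w => \sum_i a i * W w (h i)) m s,
      forall h, expectation P (W ^~ h) = 0%E &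
      forall h1 h2, covariance P (W ^~ h1) (W ^~ h2) =
        (L2inner (lam p) (odom p) (sval h1) (sval h2))%:E].

Definition iid_standard_normal (d0 : measure_display)
    (Om : measurableType d0) (P : probability Om R) (n : nat)
    (W : Om -> 'I_n -> R) : Prop :=
  (forall i, has_normal_law P (W ^~ i) 0 1) /\
  forall B : 'I_n -> set R, (forall i, measurable (B i)) ->
    P [set w | forall i, B i (W w i)] = (\prod_i P [set w | B i (W w i)])%E.

(* xi n is the complete noise term of the n-th experiment, including the factor
   n^{-1/2} in the case of white noise. *)
Definition is_noise (d0 : measure_display) (Om : measurableType d0)
    (P : probability Om R) (o : observation) :
    (forall n, Om -> obs_index o n -> R) -> Prop :=
  match o return (forall n, Om -> obs_index o n -> R) -> Prop with
  | WhiteNoise => fun xi => exists2 W, white_noise P W &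
      forall n w h, (0 < n)%N -> xi n w h = (Num.sqrt n%:R)^-1 * W w h
  | Discrete x => fun xi =>
      forall n, (0 < n)%N -> iid_standard_normal P (xi n)
  end.

(* The observation of the function u when the noise has outcome w. *)
Definition obs (o : observation) (n : nat) (Om : Type)
    (xi : Om -> obs_index o n -> R) (u : X -> R) (w : Om) :
    data R (obs_index o n) :=
  fun i => @obs_mean o n u i + xi w i.

(* y - gtilde *)
Definition obs_shift (o : observation) (n : nat)
    (y : data R (obs_index o n)) : data R (obs_index o n) :=
  fun i => y i - @obs_mean o n (gtilde p) i.

End Observation.
Arguments observation R d : clear implicits.
Arguments WhiteNoise {R d}.

(* kappa is a regular version of the conditional law of th given Z under mu;
   E is an event of full probability outside of which th and Z are junk. *)
Definition posterior (dS dY dT : measure_display) (S : measurableType dS)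
    (Y : measurableType dY) (T : measurableType dT) (R : realType)
    (mu : {measure set S -> \bar R}) (E : set S) (th : S -> T) (Z : S -> Y)
    (kappa : R.-pker Y ~> T) : Prop :=
  forall A B, measurable A -> measurable B ->
    (\int[mu]_(s in E `&` Z @^-1` A) kappa (Z s) B)%E =
    mu (E `&` Z @^-1` A `&` th @^-1` B).

Section Credible.
Context {R : realType} {d : nat}.
Local Notation X := (eucl R d).
Context {V : normedModType R}.
Variables (p : pde (d := d) V) (m : solution_map p).
Variables (o : observation R d) (n : nat).
Context {d0 : measure_display} {Om : measurableType d0}.
Variables (P : probability Om R) (xi : Om -> obs_index p o n -> R).
Variable prior : probability (borel V) R.
Local Notation Y := (data R (obs_index p o n)).

(* In both models the pair (v, w) has law prior \x P. *)
Definition posterior_L (PiL : R.-pker Y ~> borel V) : Prop :=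
  posterior (prior \x P)%E setT fst
    (fun s => obs xi (kop p s.1) s.2) PiL.

Definition posterior_N (PiN : R.-pker Y ~> fspace m) : Prop :=
  posterior (prior \x P)%E (edom m `*` setT) (fun s => emap m s.1 : fspace m)
    (fun s => obs xi (usol m (emap m s.1)) s.2) PiN.

(* A jointly measurable random set whose posterior probability is prescribed. *)
Definition credible_set (PiL : R.-pker Y ~> borel V) (gamma : R)
    (Ct : Y -> set V) : Prop :=
  measurable [set yv : Y * borel V | Ct yv.1 yv.2] /\
  {ae (prior \x P)%E, forall s,
     PiL (obs xi (kop p s.1) s.2) (Ct (obs xi (kop p s.1) s.2)) = gamma%:E}.

Definition transformed_set (Ct : Y -> set V) (y : Y) : set (X -> R) :=
  [set f | params m f /\ Ct (obs_shift y) (lop p (usol m f))].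

End Credible.

Definition diam (R : realType) (T : Type) (dist : T -> T -> \bar R)
    (A : set T) : \bar R :=
  ereal_sup [set dist a b | a in A & b in A].

(* On the events E n, X n = O_P(r n).  The exceptional sets need not be
   measurable and are only required to be covered by small events. *)
Definition bigOP_on (R : realType) (d0 : measure_display)
    (Om : measurableType d0) (P : probability Om R) (E : nat -> set Om)
    (X r : nat -> Om -> \bar R) : Prop :=
  forall eps : R, 0 < eps -> exists M : R, forall n, (0 < n)%N ->
    exists A : set Om, [/\ measurable A, (P A <= eps%:E)%E &
      forall w, ~ A w -> E n w -> (X n w <= M%:E * r n w)%E].

(* Main.v *)
Require Import Defs.
From HB Require Import structures.
From mathcomp Require Import all_boot all_order all_algebra.
From mathcomp Require Import all_classical all_reals all_analysis.
From mathcomp Require Import measurable_realfun.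

Set Implicit Arguments.
Unset Strict Implicit.
Unset Printing Implicit Defensive.

Import Order.TTheory GRing.Theory Num.Theory.
Import numFieldNormedType.Exports.

Local Open Scope classical_set_scope.
Local Open Scope ring_scope.

(* By uniqueness for the boundary problem, u_(e(v)) = K v + gtilde on the domain
   of e, so that v |-> e(v) is a bijection from edom onto params with inverse
   f |-> L u_f, and the two observations differ by the shift by gtilde.  The
   descriptions of C_n and the coverage levels follow by substitution.
   As the posteriors are only regular conditional laws, on possibly non-separable
   spaces, they need not agree as measures almost surely.  The defining identity
   of a posterior, however, extends from rectangles to jointly measurable sets by
   a Dynkin argument; applied to the random sets it shows that the two credible
   levels, as functions of the data, have the same integrals over all data
   events, hence agree almost surely.
   The diameters are compared by the triangle inequality through vbar_n. *)

(** * The boundary problem: inverting [e], and the shift between the two observations *)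

Section SolutionMap.
Context {R : realType} {d : nat} {V : normedModType R}.
Variables (p : pde (d := d) V) (m : solution_map p).

Lemma usp_add u w : usp p u -> usp p w -> usp p (fun x => u x + w x).
Proof.
move=> hu hw; have := usp_linear 1 hu hw.
by congr (usp p _); apply/funext => x; rewrite mul1r.
Qed.

Lemma usp_kop_gtilde v : usp p (fun x => kop p v x + gtilde p x).
Proof. by apply: usp_add; [exact: kop_space|exact: gtilde_space]. Qed.

Lemma lop_kop_gtilde v : lop p (fun x => kop p v x + gtilde p x) = v.
Proof.
have := lop_linear 1 (kop_space p v) (gtilde_space p).
rewrite gtilde_null kop_inverse addr0 scale1r => {2}<-.
by congr (lop p _); apply/funext => x; rewrite mul1r.
Qed.

Lemma btrace_kop_gtilde v x :
  bndy p x -> btrace p (fun x => kop p v x + gtilde p x) x = bval p x.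
Proof.
move=> Gx; have [tr_lin _] := btrace_trace p.
have := tr_lin x Gx 1 _ _ (kop_space p v) (gtilde_space p).
rewrite kop_boundary// gtilde_boundary// scaler0 add0r => <-.
by congr (btrace p _ x); apply/funext => y; rewrite mul1r.
Qed.

(** The difference of the two sides is annihilated by [lop] and has zero boundary values, so
    uniqueness for the homogeneous problem makes it vanish. *)
Lemma solution_kop_lop f w : solution p f w ->
  w = (fun x => kop p (lop p w) x + gtilde p x).
Proof.
move=> [hw _ bw]; have hk := usp_kop_gtilde (lop p w).
(* The factor [-1] gives the difference the shape [a * u + w] in which the linearity of [usp], [lop]
   and [btrace] is stated. *)
pose z x := -1 * (kop p (lop p w) x + gtilde p x) + w x.
suff z0 : z = (fun=> 0).
  apply/funext => x; apply/eqP; rewrite -subr_eq0.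
  by have /(congr1 (@^~ x)) := z0; rewrite /z/= mulN1r addrC => ->.
apply: (@lop_unique _ _ _ p).
- exact: usp_linear.
- by rewrite lop_linear// lop_kop_gtilde scaleN1r addNr.
- move=> x Gx; have [/(_ _ Gx) tr_lin _] := btrace_trace p.
  by rewrite tr_lin// btrace_kop_gtilde// bw// scaleN1r addNr.
Qed.

(** If [v] comes from a solution, this is the representation of solutions just proved; otherwise it
    is the convention that defines [usol] at [emap m v]. *)
Lemma usol_emap v : edom m v ->
  usol m (emap m v) = (fun x => kop p v x + gtilde p x).
Proof.
move=> hv.
have [[f hf ->]|] := pselect (exists2 f, fset m f & v = lop p (usol m f)).
  by rewrite emap_solution//; exact: (solution_kop_lop (usol_solution hf)).
exact: usol_convention.
Qed.

Lemma lop_usol_emap v : edom m v -> lop p (usol m (emap m v)) = v.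
Proof. by move=> hv; rewrite usol_emap// lop_kop_gtilde. Qed.

(** At design points this is evaluation. Under white noise the integral may be split because a
    product of two functions in L2 is integrable; [obs_defined] puts [usp] into L2. *)
Lemma obs_mean_add (o : observation R d) (n : nat) (u w : eucl R d -> R)
    (i : obs_index p o n) : obs_defined p o -> usp p u -> usp p w ->
  @obs_mean R d V p o n (fun x => u x + w x) i =
  @obs_mean R d V p o n u i + @obs_mean R d V p o n w i.
Proof.
case: o i => [|x]//= [h [hf h2]] uL2 hu hw.
have [_ u2] := uL2 _ hu; have [_ w2] := uL2 _ hw.
have mO : measurable (odom p : set (borel (eucl R d))).
  by apply: sub_gen_smallest; exact: odom_open.
have int u' : (u' : borel (eucl R d) -> R) \in Lfun (lam p) 2%:E ->
    (lam p).-integrable (odom p : set (borel (eucl R d)))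
      (EFin \o (fun x => h x * u' x)).
  move=> u'2; apply: (@integrableS _ _ _ _ setT) => //.
  exact/Lfun1_integrable/Lfun2_mul_Lfun1.
rewrite /L2inner -RintegralD//; [|exact: int|exact: int].
by congr (Rintegral _ _ _); apply/funext => x; rewrite mulrDr.
Qed.

Lemma obs_shift_usol_emap (o : observation R d) (n : nat) (Om : Type)
    (xi : Om -> obs_index p o n -> R) v w :
  obs_defined p o -> edom m v ->
  obs_shift (obs xi (usol m (emap m v)) w) = obs xi (kop p v) w.
Proof.
move=> ho hv; apply/funext => i; rewrite /obs_shift /obs usol_emap//.
rewrite obs_mean_add//; [|exact: kop_space|exact: gtilde_space].
by rewrite addrAC addrK.
Qed.

Lemma transformed_setE (o : observation R d) (n : nat)
    (Ct : data R (obs_index p o n) -> set V) y :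
  transformed_set m Ct y =
  [set emap m v | v in edom m `&` Ct (obs_shift y)].
Proof.
apply/seteqP; split=> [f [[v hv <-]]|f [v [hv Cv] <-]].
  by rewrite lop_usol_emap// => Cv; exists v.
by split; [exists v|rewrite lop_usol_emap].
Qed.

Lemma emap_transformed_set (o : observation R d) (n : nat)
    (Ct : data R (obs_index p o n) -> set V) y v : edom m v ->
  transformed_set m Ct y (emap m v) = Ct (obs_shift y) v.
Proof.
move=> hv; apply/propext; rewrite /transformed_set/= lop_usol_emap//.
by split=> [[]//|Cv]; split=> //; exists v.
Qed.

End SolutionMap.

(** * Posterior probabilities of random sets, and almost sure equality of functions of the data *)

Lemma measurable_fun_pair_in (d d1 d2 : measure_display) (T : measurableType d)
    (T1 : measurableType d1) (T2 : measurableType d2) (D : set T)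
    (f : T -> T1) (g : T -> T2) :
  measurable_fun D f -> measurable_fun D g ->
  measurable_fun D (fun x => (f x, g x)).
Proof.
move=> mf mg mD; apply: measurability (mD).
  exact: measurable_prod_measurableType.
move=> _ [_ [A mA [B mB <-]] <-].
rewrite [X in measurable X](_ : _ = (D `&` f @^-1` A) `&` (D `&` g @^-1` B)).
  by apply: measurableI; [exact: mf|exact: mg].
by apply/seteqP; split => x /=; tauto.
Qed.

Section PosteriorOfRandomSets.
Context (dS dY dT : measure_display) (S : measurableType dS)
  (Y : measurableType dY) (T : measurableType dT) (R : realType).
Variables (mu : {finite_measure set S -> \bar R}) (E : set S).
Variables (th : S -> T) (Z : S -> Y) (kappa : R.-pker Y ~> T).
Hypotheses (mE : measurable E) (mth : measurable_fun E th)
  (mZ : measurable_fun E Z) (post : posterior mu E th Z kappa).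

(** The case [D = B1 * B2] is the definition of a posterior. The sets [D] with this identity form a
    Dynkin system, and rectangles are stable under intersection. *)
Lemma posterior_xsection (A : set Y) (D : set (Y * T)) :
    measurable A -> measurable D ->
  (\int[mu]_(s in E `&` Z @^-1` A) kappa (Z s) (xsection D (Z s)))%E =
  mu (E `&` Z @^-1` A `&` [set s | D (Z s, th s)]).
Proof.
move=> mA mD; set EA := E `&` Z @^-1` A.
have mEA : measurable EA by exact: mZ.
have mZEA : measurable_fun EA Z.
  by apply: measurable_funS mZ => //; exact: subIsetl.
have mthEA : measurable_fun EA th.
  by apply: measurable_funS mth => //; exact: subIsetl.
pose g B y : \bar R := kappa y (xsection B y).
have mk B : measurable B -> measurable_fun EA (g B \o Z).
  move=> mB; apply: measurableT_comp => //.
  by apply: measurable_fun_xsection_finite_kernel; rewrite inE.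
have mZth B : measurable B -> measurable (EA `&` [set s | B (Z s, th s)]).
  by move=> mB; exact: (measurable_fun_pair_in mZEA mthEA).
move: mD; rewrite measurable_prod_measurableType; move: D.
apply: dynkin_induction.
- by rewrite measurable_prod_measurableType.
- move=> _ _ [A1 mA1 [A2 mA2 <-]] [B1 mB1 [B2 mB2 <-]].
  exists (A1 `&` B1); first exact: measurableI.
  exists (A2 `&` B2); first exact: measurableI.
  by rewrite setXI.
- rewrite -(post mA measurableT).
  by apply: eq_integral => s _; rewrite xsectionE.
- move=> _ [A1 mA1 [A2 mA2 <-]].
  (* The section of a rectangle at [Z s] is [A2] or empty according to whether [Z s] lies in [A1],
     so [A1] can be absorbed into the data event. *)
  transitivity (\int[mu]_(s in E `&` Z @^-1` (A `&` A1)) kappa (Z s) A2)%E.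
    rewrite preimage_setI setIA [RHS]integral_mkcondr.
    apply: eq_integral => s _; rewrite patchE.
    case: ifPn => [|]; rewrite ?inE// => hs; first by rewrite in_xsectionX ?inE.
    by rewrite notin_xsectionX ?inE// measure0.
  rewrite post//; last exact: measurableI.
  by congr (mu _); rewrite /EA; apply/seteqP; split => s /=; tauto.
- move=> D mD IH.
  (* Complements: after adding the known identity for [D], both sides become the total mass of [EA].
     The added term is finite, hence can be cancelled. *)
  have : (mu (EA `&` [set s | D (Z s, th s)]) +
      \int[mu]_(s in EA) kappa (Z s) (xsection (~` D) (Z s)) =
      mu (EA `&` [set s | D (Z s, th s)]) +
      mu (EA `&` [set s | (~` D) (Z s, th s)]))%E.
    rewrite -measureU//; last 3 first.
    + exact: mZth.
    + exact/mZth/measurableC.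
    + by apply/seteqP; split => // s /= [[_ ?] [_ ?]].
    rewrite -setIUr.
    have -> : [set s | D (Z s, th s)] `|` [set s | (~` D) (Z s, th s)] = setT.
      by apply/seteqP; split => // s _ /=; exact: EM.
    transitivity (\int[mu]_(s in EA) kappa (Z s) setT)%E; last first.
      exact: (post mA measurableT).
    rewrite -IH -ge0_integralD//; last 2 first.
    + exact: mk.
    + exact/mk/measurableC.
    apply: eq_integral => s _; rewrite -measureU//.
    + congr (kappa _ _); rewrite !xsectionE.
      by apply/seteqP; split => // t _ /=; exact: EM.
    + exact: measurable_xsection.
    + exact/measurable_xsection/measurableC.
    + by rewrite !xsectionE; apply/seteqP; split => // t /= [].
  rewrite addeC [RHS]addeC.
  move=> /(congr1 (fun x => x - mu (EA `&` [set s | D (Z s, th s)]))%E).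
  by rewrite !addeK//; apply: fin_num_measure; exact: mZth.
- move=> F mF tF IH.
  transitivity (\int[mu]_(s in EA)
      \sum_(0 <= k <oo) kappa (Z s) (xsection (F k) (Z s)))%E.
    apply: eq_integral => s _; rewrite xsection_bigcup measure_semi_bigcup//.
    + by move=> k; exact: measurable_xsection.
    + exact: trivIset_xsection.
    + by apply: bigcupT_measurable => k; exact: measurable_xsection.
  rewrite integral_nneseries//; last by move=> k; exact: mk.
  under eq_eseriesr do rewrite IH.
  have -> : [set s | (\bigcup_k F k) (Z s, th s)] =
      \bigcup_k [set s | F k (Z s, th s)].
    by [].
  rewrite setI_bigcupr measure_semi_bigcup//.
  + by move=> k; exact: mZth.
  + apply/trivIsetP => i j _ _ ij.
    move/trivIsetP : tF => /(_ i j Logic.I Logic.I ij) Fij.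
    apply/seteqP; split => // s /= [[_ Fi] [_ Fj]].
    by have : (F i `&` F j) (Z s, th s) by []; rewrite Fij.
  + by apply: bigcupT_measurable => k; exact: mZth.
Qed.

End PosteriorOfRandomSets.

(** Under the image of [mu] by [Z], the functions [g] and [h] have equal integrals over all
    measurable sets, hence agree almost everywhere. The bound on [g] supplies integrability, and the
    exceptional null set is pulled back along [Z]. *)
Lemma ae_eq_comp (dS dY : measure_display) (S : measurableType dS)
    (Y : measurableType dY) (R : realType)
    (mu : {finite_measure set S -> \bar R}) (Z : S -> Y) (g h : Y -> \bar R) :
  measurable_fun setT Z -> measurable_fun setT g -> measurable_fun setT h ->
  (forall y, 0 <= g y <= 1)%E -> (forall y, 0 <= h y)%E ->
  (forall A, measurable A ->
    \int[mu]_(s in Z @^-1` A) g (Z s) = \int[mu]_(s in Z @^-1` A) h (Z s))%E ->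
  {ae mu, forall s, g (Z s) = h (Z s)}.
Proof.
move=> mZ mg mh g01 h0 gh.
have mZA A : measurable A -> measurable (Z @^-1` A).
  by move=> mA; rewrite -[X in measurable X]setTI; exact: mZ.
pose nu :=
  measure_function_pushforward__canonical__measure_function_Measure mu mZ.
have mag : measurable_fun setT (fun y => `|g y|%E).
  by apply: (measurableT_comp _ mg).
have [] : ae_eq nu setT g h.
  apply: integral_ae_eq => //.
    apply/integrableP; split=> //.
    rewrite (@ge0_integral_pushforward _ _ _ _ _ _ mZ)// preimage_setT.
    apply: (@le_lt_trans _ _ (\int[mu]_(s in setT) cst 1 s)%E).
      apply: ge0_le_integral => //.
      - by move=> s _ /=.
      - exact: (measurableT_comp mag mZ).
      - by move=> s _; have /andP[g0 g1] := g01 (Z s); rewrite /= gee0_abs.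
    by rewrite integral_cst// mul1e ltey_eq fin_num_measure.
  move=> A _ mA.
  rewrite !(@ge0_integral_pushforward _ _ _ _ _ _ mZ)//.
  - exact: gh.
  - exact: measurable_funTS.
  - exact: measurable_funTS.
  - by move=> y _; have /andP[] := g01 y.
move=> N [mN nuN gN]; exists (Z @^-1` N); split => //; first exact: mZA.
by move=> s /= ghs; apply: gN => /= /(_ Logic.I).
Qed.

(** * Measurability on the space of functions [f] and on the data space *)

Section Measurability.
Context {R : realType} {d : nat} {V : normedModType R}.
Variables (p : pde (d := d) V) (m : solution_map p).

(** The generating family is already a sigma-algebra, so passing to the generated one adds no
    sets. *)
Lemma measurable_fspaceP (B : set (fspace m)) : measurable B ->
  measurable (edom m `&` emap m @^-1` B : set (borel V)).
Proof.
have mE := edom_measurable m.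
suff: @measurable _ (fspace m) `<=`
    [set B | measurable (edom m `&` emap m @^-1` B : set (borel V))] by exact.
apply: smallest_sub => //; split => /=.
- by rewrite preimage_set0 setI0.
- move=> A mA; rewrite setTD preimage_setC -setDE.
  rewrite (_ : _ `\` _ = edom m `\` (edom m `&` emap m @^-1` A)).
    exact: measurableD.
  by apply/seteqP; split => v /=; tauto.
- move=> F mF; rewrite preimage_bigcup setI_bigcupr.
  exact: bigcupT_measurable.
Qed.

Lemma measurable_fspace (B : set (fspace m)) :
  measurable (edom m `&` emap m @^-1` B : set (borel V)) -> measurable B.
Proof. by move=> mB; apply: sub_gen_smallest. Qed.

Lemma measurable_params : measurable (params m : set (fspace m)).
Proof.
apply: measurable_fspace; rewrite (_ : _ `&` _ = edom m).
  exact: edom_measurable.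
by apply/seteqP; split => [v []//|v hv]; split => //; exists v.
Qed.

(** This map inverts [e]: pulled back along [e], the preimage of [B] is just the part of [B] inside
    [edom m]. *)
Lemma measurable_lop_usol :
  measurable_fun (params m : set (fspace m))
    (fun f : fspace m => lop p (usol m f) : borel V).
Proof.
move=> _ B mB; apply: measurable_fspace; rewrite (_ : _ `&` _ = edom m `&` B).
  by apply: measurableI => //; exact: edom_measurable.
apply/seteqP; split => [v [hv [_]]|v [hv Bv]].
  by rewrite /= lop_usol_emap.
by split => //; split; [exists v|rewrite /= lop_usol_emap].
Qed.

Lemma measurable_fun_data (I : Type) (dT : measure_display)
    (T : measurableType dT) (Z : T -> data R I) :
  (forall i, measurable_fun setT (fun t => Z t i)) -> measurable_fun setT Z.
Proof.
move=> mZ; apply: measurability; first exact: erefl.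
by move=> _ [_ [i [B [mB ->]]] <-]; exact: mZ.
Qed.

Lemma measurable_coordinate (I : Type) (i : I) :
  measurable_fun setT (fun y : data R I => y i).
Proof.
move=> _ B mB; rewrite setTI; apply: sub_gen_smallest.
by exists i, B.
Qed.

Variables (o : observation R d) (n : nat).
Local Notation Y := (data R (obs_index p o n)).

Lemma measurable_translation (c : obs_index p o n -> R) :
  measurable_fun setT (fun y : Y => (fun i => y i + c i) : Y).
Proof.
apply: measurable_fun_data => i; apply: measurable_funD => //.
exact: measurable_coordinate.
Qed.

(** The set is the preimage, within [D], of the graph of [Ct] under the measurable map
    [shift_lop]. *)
Lemma measurable_transformed_set (Ct : Y -> set V) :
  measurable [set yv : Y * borel V | Ct yv.1 yv.2] ->
  measurable [set yf : Y * fspace m | transformed_set m Ct yf.1 yf.2].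
Proof.
move=> mCt.
pose D := [set yf : Y * fspace m | params m yf.2].
have mD : measurable D.
  have := @measurable_snd _ _ Y (fspace m) measurableT _ measurable_params.
  by rewrite setTI.
pose shift_lop (yf : Y * fspace m) : Y * borel V :=
  (obs_shift yf.1, lop p (usol m yf.2)).
have m1 : measurable_fun D (fun yf : Y * fspace m => obs_shift yf.1 : Y).
  apply: measurable_funTS; apply: measurableT_comp => //.
  exact: measurable_translation.
have m2 : measurable_fun D
    (fun yf : Y * fspace m => lop p (usol m yf.2) : borel V).
  move=> _ B mB.
  have := @measurable_snd _ _ Y (fspace m) measurableT _
    (measurable_lop_usol measurable_params mB).
  by rewrite setTI.
have : measurable_fun D shift_lop by exact: measurable_fun_pair_in.
by move=> /(_ mD _ mCt).
Qed.

End Measurability.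

(** * Almost sure equality of the credible levels *)

Lemma measure_setI_full (dT : measure_display) (T : measurableType dT)
    (R : realType) (mu : {measure set T -> \bar R}) (E F : set T) :
  measurable E -> measurable F -> mu setT \is a fin_num -> mu E = mu setT ->
  mu (E `&` F) = mu F.
Proof.
move=> mE mF muT muE; have mEC : measurable (~` E) by exact: measurableC.
have muEC : mu (~` E) = 0%E.
  have := muT; have : mu setT = (mu (~` E) + mu E)%E.
    by rewrite addeC -measureU ?setUv// setICr.
  rewrite -muE => /(congr1 (fun x => x - mu E)%E) + fE.
  by rewrite addeK// subee.
rewrite -[in RHS](setIT F) -(setUv E) setIUr [RHS]measureU//.
- rewrite [X in (_ + X)%E](@subset_measure0 _ _ _ mu _ (~` E))//.
  + by rewrite adde0 setIC.
  + exact: measurableI.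
- exact: measurableI.
- exact: measurableI.
- by rewrite setIACA setICr setI0.
Qed.

Section CredibleLevel.
Context {R : realType} {d : nat} {V : normedModType R}.
Variables (p : pde (d := d) V) (m : solution_map p) (o : observation R d).
Context {d0 : measure_display} {Om : measurableType d0}.
Variable P : probability Om R.

Lemma measurable_noise (xi : forall n, Om -> obs_index p o n -> R) n i :
  is_noise P xi -> (0 < n)%N -> measurable_fun setT (fun w => xi n w i).
Proof.
case: o xi i => [|x] xi i /=.
  move=> [W [W_lin _ _] xiE] n0.
  (* Measurability of one coordinate is extracted from the normality of linear combinations, taken
     with a single term of coefficient 1. *)
  have [? [? [mW _]]] := W_lin 1%N (fun=> 1) (fun=> i).
  have -> : (fun w => xi n w i) =
      (fun w => (Num.sqrt n%:R)^-1 * \sum_(j < 1) 1 * W w i).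
    by apply/funext => w; rewrite xiE// big_ord1 mul1r.
  exact: measurable_funM.
by move=> xi_iid n0; have [/(_ i) []] := xi_iid n n0.
Qed.

Variables (n : nat) (xi : Om -> obs_index p o n -> R).
Variable prior : probability (borel V) R.
Hypothesis mxi : forall i, measurable_fun setT (fun w => xi w i).
Hypothesis mkop : forall i,
  measurable_fun setT (fun v : borel V => @obs_mean R d V p o n (kop p v) i).
Local Notation Y := (data R (obs_index p o n)).

Lemma measurable_obs_kop :
  measurable_fun setT (fun s : borel V * Om => obs xi (kop p s.1) s.2 : Y).
Proof.
apply: measurable_fun_data => i; apply: measurable_funD.
  exact: (measurableT_comp (mkop i) measurable_fst).
exact: (measurableT_comp (mxi i) measurable_snd).
Qed.

Hypotheses (ho : obs_defined p o) (prior_edom : prior (edom m) = 1%E).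
Variables (PiL : R.-pker Y ~> borel V) (PiN : R.-pker Y ~> fspace m).
Hypotheses (post_L : posterior_L P xi prior PiL)
  (post_N : posterior_N P xi prior PiN).
Variable Ct : Y -> set V.
Hypothesis mCt : measurable [set yv : Y * borel V | Ct yv.1 yv.2].

Let E : set (borel V * Om) := edom m `*` setT.

Let mE : measurable E.
Proof. by apply: measurableX => //; exact: edom_measurable. Qed.

Let mu_E : (prior \x P)%E E = 1%E.
Proof.
transitivity (prior (edom m) * P setT)%E.
  by apply: product_measure1E => //; exact: edom_measurable.
by rewrite prior_edom probability_setT mule1.
Qed.

Lemma ae_credible_level : {ae (prior \x P)%E, forall s,
  let y := obs xi (usol m (emap m s.1)) s.2 in
  PiN y (transformed_set m Ct y) = PiL (obs_shift y) (Ct (obs_shift y))}.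
Proof.
pose mu : probability (borel V * Om)%type R := (prior \x P)%E.
pose Z (s : borel V * Om) : Y := obs xi (kop p s.1) s.2.
pose ZN (s : borel V * Om) : Y := obs xi (usol m (emap m s.1)) s.2.
(* Adding [gtilde] back turns the data [Z] of the linear model into the data [ZN] of the nonlinear
   one on [E], so both levels can be treated as functions of [Z]. *)
pose unshift (y : Y) : Y := fun i => y i + @obs_mean R d V p o n (gtilde p) i.
have munshift : measurable_fun setT unshift by exact: measurable_translation.
have mZ : measurable_fun setT Z by exact: measurable_obs_kop.
have shiftK y : unshift (obs_shift y) = y.
  by apply/funext => i; rewrite /unshift /obs_shift subrK.
have shiftZN s : E s -> obs_shift (ZN s) = Z s.
  by move=> [hs _]; exact: obs_shift_usol_emap.
have ZNE s : E s -> ZN s = unshift (Z s) by move=> /shiftZN <-.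
have mZN : measurable_fun E ZN.
  apply: (@eq_measurable_fun _ _ _ _ E (unshift \o Z)).
    by move=> s; rewrite inE => /ZNE.
  by apply: measurable_funTS; exact: measurableT_comp.
pose D := [set yv : Y * borel V | Ct yv.1 yv.2].
pose DN := [set yf : Y * fspace m | transformed_set m Ct yf.1 yf.2].
have mDN : measurable DN by exact: measurable_transformed_set.
have xD y : xsection D y = Ct y by rewrite xsectionE.
have xDN y : xsection DN y = transformed_set m Ct y by rewrite xsectionE.
pose g y : \bar R := PiL y (Ct y).
pose hN y : \bar R := PiN y (transformed_set m Ct y).
have mg : measurable_fun setT g.
  rewrite (_ : g = fun y => PiL y (xsection D y)).
    by apply: measurable_fun_xsection_finite_kernel; rewrite inE.
  by apply/funext => y; rewrite xD.
have mhN : measurable_fun setT hN.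
  rewrite (_ : hN = fun y => PiN y (xsection DN y)).
    by apply: measurable_fun_xsection_finite_kernel; rewrite inE.
  by apply/funext => y; rewrite xDN.
have mth : measurable_fun E (fun s => emap m s.1 : fspace m).
  move=> _ B mB; rewrite (_ : _ `&` _ = (edom m `&` emap m @^-1` B) `*` setT).
    by apply: measurableX => //; exact: measurable_fspaceP.
  by apply/seteqP; split => s /=; rewrite /E /=; tauto.
have mu_EC : mu (~` E) = 0%E.
  by rewrite probability_setC// [X in (_ - X)%E]mu_E subee.
have mZA A : measurable A -> measurable (Z @^-1` A).
  by move=> mA; rewrite -[X in measurable X]setTI; exact: mZ.
have level_eq : {ae mu, forall s, g (Z s) = hN (unshift (Z s))}.
  apply: (@ae_eq_comp _ _ _ _ _ mu Z g (hN \o unshift)) => //.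
  - exact: measurableT_comp.
  - move=> y; rewrite measure_ge0/= -(@prob_kernel _ _ _ _ _ PiL y).
    by apply: le_measure; rewrite ?inE// -xD; exact: measurable_xsection.
  move=> A mA.
  (* Both integrals will equal the joint probability of the data event and of [B], the event that
     the random set contains [v]. *)
  pose B := [set s | Ct (Z s) s.1].
  have mB : measurable B.
    have := measurable_fun_pair mZ (@measurable_fst _ _ (borel V) Om).
    by move=> /(_ measurableT _ mCt); rewrite setTI.
  transitivity (mu (Z @^-1` A `&` B)).
    have := posterior_xsection (mu := mu) measurableT measurable_fst mZ post_L
      mA mCt.
    rewrite !setTI => <-.
    by apply: eq_integral => s _; rewrite xD.
  transitivity (mu (E `&` Z @^-1` A `&` B)).
    rewrite -setIA [RHS]measure_setI_full//.
    - by apply: measurableI => //; exact: mZA.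
    - exact: fin_num_measure.
    - by rewrite [LHS]mu_E [RHS]probability_setT.
  have EA : E `&` ZN @^-1` (@obs_shift _ _ _ p o n @^-1` A) = E `&` Z @^-1` A.
    by apply/seteqP; split => s [Es] /=; rewrite shiftZN.
  (* The posterior identity of the nonlinear model is used for the shifted data event. On [E], the
     transformed set contains [e(v)] exactly when the original one contains [v]. *)
  transitivity (\int[mu]_(s in E `&` Z @^-1` A) hN (ZN s))%E.
    have msA : measurable (@obs_shift _ _ _ p o n @^-1` A).
      by have := @measurable_translation _ _ _ p o n
        (fun i => - @obs_mean R d V p o n (gtilde p) i) measurableT _ mA;
        rewrite setTI.
    have := posterior_xsection (mu := mu) mE mth mZN post_N msA mDN.
    rewrite EA => post_DN; transitivity (mu (E `&` Z @^-1` A `&`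
        [set s | DN (ZN s, emap m s.1)])).
      congr (mu _); apply/seteqP; split => s [[Es As]].
        move=> Bs; split => //; rewrite /DN/= emap_transformed_set ?shiftZN//.
        by case: Es.
      by rewrite /DN/= emap_transformed_set ?shiftZN//; case: Es.
    by rewrite -post_DN; apply: eq_integral => s _; rewrite xDN.
  (* The complement of [E] is null, so the integral over the whole data event reduces to [E], where
     [ZN] is [unshift] of [Z]. *)
  rewrite [RHS](@ge0_negligible_integral _ _ _ mu _ (~` E))//.
  - rewrite setDE setCK setIC; apply: eq_integral => s.
    by rewrite inE => -[_ Es]; rewrite ZNE.
  - exact: measurableC.
  - exact: mZA.
  - apply: measurable_funTS; apply: measurableT_comp => //.
    exact: measurableT_comp.
have aeE : {ae mu, forall s, E s}.
  by exists (~` E); split => //; exact: measurableC.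
apply: filterS2 aeE level_eq => s Es /=.
by rewrite -ZNE// shiftZN// => ->.
Qed.

End CredibleLevel.

(** * Diameters and orders in probability *)

Section Diameters.
Context {R : realType} {d : nat}.
Local Notation X := (eucl R d).
Variables (lam : {measure set (borel X) -> \bar R}) (O : set X).

(** Minkowski's inequality with exponent 2. Both distances on the right end at [h], the form in
    which a Lipschitz bound at a fixed centre applies. *)
Lemma L2dist_triangle f h k : L2 lam O f -> L2 lam O h -> L2 lam O k ->
  (L2dist lam f k <= L2dist lam f h + L2dist lam k h)%E.
Proof.
have mL2 u : L2 lam O u -> measurable_fun setT (u : borel X -> R).
  by move=> [_ /sub_Lfun_mfun]; rewrite inE.
move=> /mL2 mf /mL2 mh /mL2 mk.
have -> : L2dist lam k h = L2dist lam h k.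
  rewrite /L2dist -oppe_Lnorm; apply: eq_Lnorm => x /=.
  by congr EFin; rewrite opprB.
rewrite /L2dist.
have -> : EFin \o (fun x : borel X => f x - k x) =
    EFin \o ((fun x : borel X => f x - h x) \+ (fun x : borel X => h x - k x)).
  by apply/funext => x /=; rewrite addrA subrK.
apply: eminkowski.
- exact: measurable_funB.
- exact: measurable_funB.
- by rewrite lee_fin ler1n.
Qed.

(** Two points are compared through [vbar], which lies in [A], so each leg is bounded by the
    diameter of [A]. The two legs give the factor 2; the absolute value covers a constant [k] of
    either sign. *)
Lemma diam_emap_le (V : normedModType R) (e : V -> X -> R) (A Vn : set V)
    (vbar : V) (k : R) : A `<=` Vn -> A vbar ->
  (forall v, Vn v -> L2 lam O (e v)) ->
  (forall v, Vn v -> (L2dist lam (e v) (e vbar) <= (k * `|v - vbar|)%:E)%E) ->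
  (diam (L2dist lam) [set e v | v in A] <=
    (2 * `|k|)%:E * diam (fun v v' : V => (`|v - v'|)%:E) A)%E.
Proof.
move=> AVn Abar eL2 e_lip.
apply: ge_ereal_sup => _ [_ [v Av <-] [_ [v' Av' <-] <-]].
set D := diam _ _.
have step u : A u -> (L2dist lam (e u) (e vbar) <= `|k|%:E * D)%E.
  move=> Au; apply: (le_trans (e_lip _ (AVn _ Au))).
  apply: (@le_trans _ _ (`|k| * `|u - vbar|)%:E).
    by rewrite lee_fin ler_wpM2r// ler_norm.
  rewrite EFinM lee_wpmul2l// ?lee_fin//.
  by apply: ereal_sup_ubound; exists u => //; exists vbar.
apply: (le_trans (@L2dist_triangle _ (e vbar) _ _ _ _)); try exact/eL2/AVn.
apply: (le_trans (leeD (step _ Av) (step _ Av'))).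
by rewrite mulr_natl mulr2n EFinD ge0_muleDl ?lee_fin.
Qed.

End Diameters.

Lemma bigOP_on_scale (R : realType) (d0 : measure_display)
    (Om : measurableType d0) (P : probability Om R) (E : nat -> set Om)
    (X Y r : nat -> Om -> \bar R) (k : R) : 0 <= k ->
  (forall n, (0 < n)%N ->
    {ae P, forall w, E n w -> (X n w <= k%:E * Y n w)%E}) ->
  bigOP_on P E Y r -> bigOP_on P E X r.
Proof.
move=> k0 XY Yr eps eps0; have [M YM] := Yr eps eps0.
exists (k * M) => n n0; have [A [mA PA YA]] := YM n n0.
have [N [mN PN XYN]] := XY n n0.
(* The null set on which the comparison may fail joins the exceptional set without raising its
   probability. *)
exists (A `|` N); split; first exact: measurableU.
  by rewrite measureU0.
move=> w /not_orP[nA nN] Ew.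
have {}XYN : (X n w <= k%:E * Y n w)%E.
  by apply: contrapT => H; apply: nN; apply: XYN => /= /(_ Ew).
apply: (le_trans XYN); rewrite EFinM -muleA.
by apply: lee_wpmul2l; [rewrite lee_fin|exact: YA].
Qed.

Lemma bigOP_on_refl (R : realType) (d0 : measure_display)
    (Om : measurableType d0) (P : probability Om R) (E : nat -> set Om)
    (X : nat -> Om -> \bar R) : bigOP_on P E X X.
Proof.
move=> eps eps0; exists 1 => n _; exists set0; split => //.
  by rewrite measure0 lee_fin ltW.
by move=> w _ _; rewrite mul1e.
Qed.

Theorem proposition2p2
  (R : realType) (d : nat) (V : normedModType R)
  (p : pde (d := d) V) (m : solution_map p)
  (o : observation R d) (ho : obs_defined p o)
  (d0 : measure_display) (Om : measurableType d0) (P : probability Om R)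
  (xi : forall n, Om -> obs_index p o n -> R) (hxi : is_noise P xi)
  (prior : nat -> probability (borel V) R)
  (hdom : forall n, (0 < n)%N -> prior n (edom m) = 1%E)
  (hmeas : forall n i, (0 < n)%N ->
     measurable_fun setT (fun v : borel V => @obs_mean R d V p o n (kop p v) i))
  (PiL : forall n, R.-pker (data R (obs_index p o n)) ~> borel V)
  (hPiL : forall n, (0 < n)%N -> posterior_L P (xi n) (prior n) (PiL n))
  (PiN : forall n, R.-pker (data R (obs_index p o n)) ~> fspace m)
  (hPiN : forall n, (0 < n)%N -> posterior_N P (xi n) (prior n) (PiN n))
  (gamma : nat -> R)
  (Ct : forall n, data R (obs_index p o n) -> set V)
  (hCt : forall n, (0 < n)%N ->
     credible_set P (xi n) (prior n) (PiL n) (gamma n) (Ct n))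
  (f0 : eucl R d -> R) (hf0 : params m f0) :
  let C n := transformed_set m (Ct n) in
  let v0 := lop p (usol m f0) in
  let yL n w := obs (xi n) (kop p v0) w in
  let yN n w := obs (xi n) (usol m f0) w in
  (* the two descriptions of C n *)
  (forall n y, (0 < n)%N ->
     C n y = [set emap m v | v in edom m `&` Ct n (obs_shift y)]) /\
  (* the identification of the observations in the two models *)
  (forall n w, (0 < n)%N -> obs_shift (yN n w) = yL n w) /\
  (* credible levels, almost surely in the Bayesian model and whenever the
     posterior of f is the image of that of v *)
  (forall n, (0 < n)%N ->
     {ae (prior n \x P)%E, forall s,
        let y := obs (xi n) (usol m (emap m s.1)) s.2 in
        PiN n y (C n y) = PiL n (obs_shift y) (Ct n (obs_shift y))}) /\
  (forall n y, (0 < n)%N ->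
     (forall B : set (fspace m), measurable B ->
        PiN n y B = PiL n (obs_shift y) (edom m `&` emap m @^-1` B)) ->
     PiN n y (C n y) = PiL n (obs_shift y) (Ct n (obs_shift y))) /\
  (* coverage levels *)
  (forall n, (0 < n)%N ->
     P [set w | C n (yN n w) f0] = P [set w | Ct n (yL n w) v0]) /\
  (* diameters *)
  (forall (Vn : nat -> set V) (vbar : nat -> V) (Clip : R),
     (forall n, (0 < n)%N -> Vn n `<=` edom m) ->
     (forall n v, (0 < n)%N -> Vn n v -> L2 (lam p) (odom p) (emap m v)) ->
     (forall n, (0 < n)%N -> Vn n (vbar n)) ->
     (forall n v, (0 < n)%N -> Vn n v ->
        (L2dist (lam p) (emap m v) (emap m (vbar n))
           <= (Clip * `|v - vbar n|)%:E)%E) ->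
     (forall n, (0 < n)%N -> {ae P, forall w, Ct n (yL n w) `<=` Vn n}) ->
     let E n := [set w | Ct n (yL n w) (vbar n)] in
     let diamN n w := diam (L2dist (lam p)) (C n (yN n w)) in
     let diamL n w := diam (fun v v' : V => (`|v - v'|)%:E) (Ct n (yL n w)) in
     bigOP_on P E diamN diamL /\
     forall r : nat -> R, (forall n, 0 < r n) ->
       bigOP_on P E diamL (fun n _ => (r n)%:E) ->
       bigOP_on P E diamN (fun n _ => (r n)%:E)).
Proof.
move=> C v0 yL yN; case: hf0 => v0' hv0' f0E.
have v0E : v0 = v0' by rewrite /v0 -f0E lop_usol_emap.
have shift_yN n w : obs_shift (yN n w) = yL n w.
  by rewrite /yN /yL v0E -f0E obs_shift_usol_emap.
have mxi n i (n0 : (0 < n)%N) : measurable_fun setT (fun w => xi n w i).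
  exact: measurable_noise hxi n0.
split; first by move=> n y _; exact: transformed_setE.
split; first by move=> n w _; exact: shift_yN.
split.
  move=> n n0; have [mCt _] := hCt n n0.
  exact: (ae_credible_level (mxi n ^~ n0) (hmeas n ^~ n0) ho (hdom n n0)
    (hPiL n n0) (hPiN n n0) mCt).
split.
  move=> n y n0 PiNE; have [mCt _] := hCt n n0.
  have mE := edom_measurable m.
  have mC : measurable (C n y : set (fspace m)).
    have := measurable_xsection y (measurable_transformed_set (m := m) mCt).
    by rewrite xsectionE.
  have mCty : measurable (Ct n (obs_shift y) : set (borel V)).
    by have := measurable_xsection (obs_shift y) mCt; rewrite xsectionE.
  (* Evaluating the image relation at the full space shows that the posterior of [v] charges only
     [edom m]; intersecting with [edom m] then leaves the level unchanged. *)
  have PiLE : PiL n (obs_shift y) (edom m) = 1%E.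
    by rewrite -(prob_kernel (s := PiN n) y) PiNE// setIT.
  rewrite PiNE//.
  have -> : edom m `&` emap m @^-1` C n y = edom m `&` Ct n (obs_shift y).
    by apply/seteqP; split => v [hv] /=; rewrite /C emap_transformed_set.
  by rewrite measure_setI_full// ?prob_kernel.
split.
  move=> n n0; congr (P _); apply/funext => w /=.
  by rewrite /C -[in LHS]f0E emap_transformed_set// shift_yN v0E.
move=> Vn vbar Clip VnE VnL2 Vnbar Vn_lip CtVn E diamN diamL.
have diam_le n : (0 < n)%N ->
    {ae P, forall w, E n w -> (diamN n w <= (2 * `|Clip|)%:E * diamL n w)%E}.
  move=> n0; apply: filterS (CtVn n n0) => w CtVnw Ew.
  (* Since the credible set lies in [Vn n], hence in [edom m], the transformed set is its full image
     under [e]. *)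
  rewrite /diamN /C transformed_setE shift_yN setIidr; last first.
    by move=> v /CtVnw; exact: VnE.
  by apply: (diam_emap_le CtVnw Ew) => v Vv; [exact: VnL2 Vv|exact: Vn_lip].
have k0 : 0 <= 2 * `|Clip| by rewrite mulr_ge0.
(* The constant in [diam_le] does not depend on [n], so any bound in probability for [diamL] passes
   to [diamN], in particular the trivial bound by itself. *)
split; first exact: bigOP_on_scale k0 diam_le (@bigOP_on_refl _ _ _ _ _ _).
by move=> r _; exact: bigOP_on_scale k0 diam_le.
Qed.
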